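(* For all GKAT expressions $e, f \in \mathrm{Exp}$, \[ [\![e]\!] = [\![f]\!] \quad\Longleftrightarrow\quad \text{for every relational interpretation } i,\ \mathcal{R}_i[\![e]\!] = \mathcal{R}_i[\![f]\!]. \] That is, the language model is sound and complete for the relational model.
   Context: Syntax. Fix disjoint nonempty sets $\Sigma$ (actions) and $T=\{t_1,\dots,t_n\}$ (primitive tests), $T$ finite. Boolean expressions $b,c\in\mathrm{BExp}$ are generated by $0 \mid 1 \mid t\in T \mid b\cdot c \mid b+c \mid \overline{b}$. GKAT expressions $e,f\in\mathrm{Exp}$ are generated by $p\in\Sigma \mid b\in\mathrm{BExp} \mid e\cdot f \mid e+_b f \mid e^{(b)}$ (do $p$; assert $b$; sequencing; if $b$ then $e$ else $f$; while $b$ do $e$). $\equiv_{BA}$ denotes Boolean equivalence, $b\le c$ iff $b+c\equiv_{BA}c$. $\mathrm{At}$ is the finite set of atoms (minimal nonzero elements) of the free Boolean algebra $\mathrm{BExp}/{\equiv_{BA}}$ on $T$, i.e. truth assignments on $T$. Language model. Guarded strings: $\mathrm{GS}=\mathrm{At}\cdot(\Sigma\cdot\mathrm{At})^*$. Fusion product: $x\alpha\diamond\beta y = x\alpha y$ if $\alpha=\beta$, undefined otherwise; for $L,K\subseteq\mathrm{GS}$, $L\diamond K=\{x\diamond y : x\in L,y\in K, x \diamond y \text{ defined}\}$; $L^0=\mathrm{At}$, $L^{n+1}=L^n\diamond L$. For $B\subseteq\mathrm{At}$, $\overline{B}=\mathrm{At}\setminus B$, $L+_BK=(B\diamond L)\cup(\overline{B}\diamond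 K)$, $L^{(B)}=\bigcup_{n\ge0}(B\diamond L)^n\diamond\overline{B}$. Then $[\![-]\!]:\mathrm{Exp}\to 2^{\mathrm{GS}}$ is: $[\![p]\!]=\{\alpha p\beta:\alpha,\beta\in\mathrm{At}\}$, $[\![b]\!]=\{\alpha\in\mathrm{At}:\alpha\le b\}$, $[\![e\cdot f]\!]=[\![e]\!]\diamond[\![f]\!]$, $[\![e+_bf]\!]=[\![e]\!]+_{[\![b]\!]}[\![f]\!]$, $[\![e^{(b)}]\!]=[\![e]\!]^{([\![b]\!])}$. Relational model. A relational interpretation is a triple $i=(\mathrm{State},\mathrm{eval},\mathrm{sat})$ consisting of a set $\mathrm{State}$, a binary relation $\mathrm{eval}(p)\subseteq\mathrm{State}\times\mathrm{State}$ for each $p\in\Sigma$, and a set $\mathrm{sat}(t)\subseteq\mathrm{State}$ for each $t\in T$. Let $\mathrm{sat}^\dagger:\mathrm{BExp}\to2^{\mathrm{State}}$ be the usual lifting of $\mathrm{sat}$ to Boolean expressions ($0\mapsto\emptyset$, $1\mapsto\mathrm{State}$, $\cdot\mapsto\cap$, $+\mapsto\cup$, negation $\mapsto$ complement). The relations $\mathcal{R}_i[\![e]\!]\subseteq\mathrm{State}\times\mathrm{State}$ are the smallest satisfying: - if $(\sigma,\sigma')\in\mathrm{eval}(p)$ then $(\sigma,\sigma')\in\mathcal{R}_i[\![p]\!]$; - if $\sigma\in\mathrm{sat}^\dagger(b)$ then $(\sigma,\sigma)\in\mathcal{R}_i[\![b]\!]$; - if $(\sigma,\sigma')\in\mathcal{R}_i[\![e]\!]$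 and $(\sigma',\sigma'')\in\mathcal{R}_i[\![f]\!]$ then $(\sigma,\sigma'')\in\mathcal{R}_i[\![e\cdot f]\!]$; - if $\sigma\in\mathrm{sat}^\dagger(b)$ and $(\sigma,\sigma')\in\mathcal{R}_i[\![e]\!]$ then $(\sigma,\sigma')\in\mathcal{R}_i[\![e+_bf]\!]$; - if $\sigma\in\mathrm{sat}^\dagger(\overline{b})$ and $(\sigma,\sigma')\in\mathcal{R}_i[\![f]\!]$ then $(\sigma,\sigma')\in\mathcal{R}_i[\![e+_bf]\!]$; - if $\sigma\in\mathrm{sat}^\dagger(b)$, $(\sigma,\sigma')\in\mathcal{R}_i[\![e]\!]$ and $(\sigma',\sigma'')\in\mathcal{R}_i[\![e^{(b)}]\!]$ then $(\sigma,\sigma'')\in\mathcal{R}_i[\![e^{(b)}]\!]$; - if $\sigma\in\mathrm{sat}^\dagger(\overline{b})$ then $(\sigma,\sigma)\in\mathcal{R}_i[\![e^{(b)}]\!]$. *)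

(* Defs.v *)
From mathcomp Require Import all_boot.
From mathcomp Require Import boolp classical_sets.

Set Implicit Arguments.
Unset Strict Implicit.
Unset Printing Implicit Defensive.

Local Open Scope classical_set_scope.

Inductive bexp (T : Type) : Type :=
| BZero
| BOne
| BPrim of T
| BAnd of bexp T & bexp T
| BOr of bexp T & bexp T
| BNot of bexp T.

Arguments BZero {T}.
Arguments BOne {T}.

Inductive exp (Sigma T : Type) : Type :=
| Act of Sigma
| Test of bexp T
| Seq of exp Sigma T & exp Sigma T
| Ite of bexp T & exp Sigma T & exp Sigma T
| While of bexp T & exp Sigma T.

Arguments Act {Sigma T}.
Arguments Test {Sigma T}.

(* The least congruence containing the Boolean algebra axioms: the quotient
   of [bexp T] by it is the free Boolean algebra on [T]. *)
Inductive ba_equiv (T : Type) : bexp T -> bexp T -> Prop :=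
| BA_refl b : ba_equiv b b
| BA_sym b c : ba_equiv b c -> ba_equiv c b
| BA_trans b c d : ba_equiv b c -> ba_equiv c d -> ba_equiv b d
| BA_congr_and b b' c c' :
    ba_equiv b b' -> ba_equiv c c' -> ba_equiv (BAnd b c) (BAnd b' c')
| BA_congr_or b b' c c' :
    ba_equiv b b' -> ba_equiv c c' -> ba_equiv (BOr b c) (BOr b' c')
| BA_congr_not b b' : ba_equiv b b' -> ba_equiv (BNot b) (BNot b')
| BA_andC b c : ba_equiv (BAnd b c) (BAnd c b)
| BA_orC b c : ba_equiv (BOr b c) (BOr c b)
| BA_andA b c d : ba_equiv (BAnd b (BAnd c d)) (BAnd (BAnd b c) d)
| BA_orA b c d : ba_equiv (BOr b (BOr c d)) (BOr (BOr b c) d)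
| BA_andK b c : ba_equiv (BAnd b (BOr b c)) b
| BA_orK b c : ba_equiv (BOr b (BAnd b c)) b
| BA_and_or b c d :
    ba_equiv (BAnd b (BOr c d)) (BOr (BAnd b c) (BAnd b d))
| BA_or_and b c d :
    ba_equiv (BOr b (BAnd c d)) (BAnd (BOr b c) (BOr b d))
| BA_and1 b : ba_equiv (BAnd b BOne) b
| BA_or0 b : ba_equiv (BOr b BZero) b
| BA_andN b : ba_equiv (BAnd b (BNot b)) BZero
| BA_orN b : ba_equiv (BOr b (BNot b)) BOne.

Definition ba_le (T : Type) (b c : bexp T) : Prop := ba_equiv (BOr b c) c.

(* An atom of the free Boolean algebra on the finite set [T] is identified
   with a truth assignment; [atom_bexp a] is the conjunction of the
   corresponding literals, which represents it in [bexp T]. *)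
Notation atom T := {ffun T -> bool}.

Definition atom_bexp (T : finType) (a : atom T) : bexp T :=
  foldr (fun t b => BAnd (if a t then BPrim t else BNot (BPrim t)) b)
    BOne (enum T).

(* The guarded string a0 p1 a1 ... pn an is encoded as
   (a0, [:: (p1, a1); ...; (pn, an)]). *)
Definition gstring (Sigma : Type) (T : finType) : Type :=
  (atom T * seq (Sigma * atom T))%type.

Definition gs_last (Sigma : Type) (T : finType) (x : gstring Sigma T) : atom T :=
  last x.1 (map snd x.2).

Definition fusion (Sigma : Type) (T : finType) (x y : gstring Sigma T) :
    option (gstring Sigma T) :=
  if gs_last x == y.1 then Some (x.1, x.2 ++ y.2) else None.

Section Languages.
Variables (Sigma : Type) (T : finType).
Implicit Types (B : set (atom T)) (L K : set (gstring Sigma T)).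

(* The inclusion of At into the guarded strings. *)
Definition at_lang B : set (gstring Sigma T) := [set (a, [::]) | a in B].

Definition lang_fusion L K : set (gstring Sigma T) :=
  [set z | exists x y, [/\ L x, K y & fusion x y = Some z]].

Fixpoint lang_pow L (n : nat) : set (gstring Sigma T) :=
  if n is m.+1 then lang_fusion (lang_pow L m) L else at_lang setT.

Definition lang_ite B L K : set (gstring Sigma T) :=
  lang_fusion (at_lang B) L `|` lang_fusion (at_lang (~` B)) K.

Definition lang_while B L : set (gstring Sigma T) :=
  \bigcup_n lang_fusion (lang_pow (lang_fusion (at_lang B) L) n)
              (at_lang (~` B)).

Definition test_sem (b : bexp T) : set (atom T) :=
  [set a | ba_le (atom_bexp a) b].

Fixpoint lang_sem (e : exp Sigma T) : set (gstring Sigma T) :=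
  match e with
  | Act p => [set x | exists a b : atom T, x = (a, [:: (p, b)])]
  | Test b => at_lang (test_sem b)
  | Seq e f => lang_fusion (lang_sem e) (lang_sem f)
  | Ite b e f => lang_ite (test_sem b) (lang_sem e) (lang_sem f)
  | While b e => lang_while (test_sem b) (lang_sem e)
  end.

End Languages.

Record rel_interp (Sigma T : Type) : Type := RelInterp {
  State : Type;
  eval : Sigma -> set (State * State);
  sat : T -> set State
}.

Arguments eval {Sigma T} i p : rename.
Arguments sat {Sigma T} i t : rename.

Section Relations.
Variables (Sigma T : Type) (i : rel_interp Sigma T).

Fixpoint sat_dagger (b : bexp T) : set (State i) :=
  match b with
  | BZero => set0
  | BOne => setT
  | BPrim t => sat i t
  | BAnd b c => sat_dagger b `&` sat_dagger c
  | BOr b c => sat_dagger b `|` sat_dagger c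
  | BNot b => ~` sat_dagger b
  end.

Inductive rel_sem : exp Sigma T -> set (State i * State i) :=
| RAct p s s' : eval i p (s, s') -> rel_sem (Act p) (s, s')
| RTest b s : sat_dagger b s -> rel_sem (Test b) (s, s)
| RSeq e f s s' s'' :
    rel_sem e (s, s') -> rel_sem f (s', s'') -> rel_sem (Seq e f) (s, s'')
| RIteT b e f s s' :
    sat_dagger b s -> rel_sem e (s, s') -> rel_sem (Ite b e f) (s, s')
| RIteF b e f s s' :
    sat_dagger (BNot b) s -> rel_sem f (s, s') -> rel_sem (Ite b e f) (s, s')
| RWhileT b e s s' s'' :
    sat_dagger b s -> rel_sem e (s, s') -> rel_sem (While b e) (s', s'') ->
    rel_sem (While b e) (s, s'')
| RWhileF b e s :
    sat_dagger (BNot b) s -> rel_sem (While b e) (s, s).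

End Relations.

Arguments sat_dagger {Sigma T} i b.
Arguments rel_sem {Sigma T} i e.

(* Main.v *)
Require Import Defs.
From Stdlib Require Import Setoid Morphisms.
From mathcomp Require Import all_boot.
From mathcomp Require Import boolp classical_sets.

(** Every state [s] of an interpretation determines the atom of the tests it
    satisfies, so a guarded string can be run from [s]: each atom must be the one
    of the current state, and each action is a step of [eval]. The relation
    [R_i[e]] is the union of the runs of the guarded strings of [e], hence is
    determined by the language. Conversely, in the interpretation whose states
    are guarded strings and whose actions append a letter, running [z] from [x]
    leads exactly to the fusion of [x] and [z], so the language can be read off
    the relation. *)

Set Implicit Arguments.
Unset Strict Implicit.
Unset Printing Implicit Defensive.

Local Open Scope classical_set_scope.

(* Equational reasoning in the free Boolean algebra, by setoid rewriting *)
#[local] Hint Resolve BA_refl : core.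

#[local] Instance ba_equiv_Equivalence (T : Type) : Equivalence (@ba_equiv T).
Proof.
by split; [exact: BA_refl | exact: BA_sym | exact: BA_trans].
Qed.

#[local] Instance BAnd_Proper (T : Type) :
  Proper (@ba_equiv T ==> @ba_equiv T ==> @ba_equiv T) (@BAnd T).
Proof. by move=> b b' bb' c c' cc'; exact: BA_congr_and. Qed.

#[local] Instance BOr_Proper (T : Type) :
  Proper (@ba_equiv T ==> @ba_equiv T ==> @ba_equiv T) (@BOr T).
Proof. by move=> b b' bb' c c' cc'; exact: BA_congr_or. Qed.

Section BooleanAlgebra.
Variable T : Type.
Implicit Types b c x : bexp T.

Lemma ba_andxx b : ba_equiv (BAnd b b) b.
Proof. by rewrite -{2}(BA_or0 b) BA_andK. Qed.

Lemma ba_orxx b : ba_equiv (BOr b b) b.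
Proof. by rewrite -{2}(BA_and1 b) BA_orK. Qed.

Lemma ba_andx0 b : ba_equiv (BAnd b BZero) BZero.
Proof. by rewrite -{1}(BA_andN b) BA_andA ba_andxx BA_andN. Qed.

Lemma ba_leP b c : ba_le b c <-> ba_equiv (BAnd b c) b.
Proof.
rewrite /ba_le; split=> bc; first by rewrite -{1}bc BA_andK.
by rewrite -bc BA_orC BA_andC BA_orK.
Qed.

(** This is the negation case of [atom_and]. If [x] lies below [b], then [x] meets [BNot b] in zero
    because [b] does; if [x] meets [b] in zero, expanding [x] over [b] and its complement leaves
    only the second part. *)
Lemma ba_andNE x b (v : bool) :
  ba_equiv (BAnd x b) (if v then x else BZero) ->
  ba_equiv (BAnd x (BNot b)) (if ~~ v then x else BZero).
Proof.
case: v => /= xb; first by rewrite -xb -BA_andA BA_andN ba_andx0.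
by rewrite -{2}(BA_and1 x) -(BA_orN b) BA_and_or xb (BA_orC BZero) BA_or0.
Qed.

End BooleanAlgebra.

Fixpoint beval (T : Type) (a : T -> bool) (b : bexp T) : bool :=
  match b with
  | BZero => false
  | BOne => true
  | BPrim t => a t
  | BAnd b c => beval a b && beval a c
  | BOr b c => beval a b || beval a c
  | BNot b => ~~ beval a b
  end.

(** Soundness of the axioms in the two-element Boolean algebra, where each of them is a truth table
    check. *)
Lemma ba_equiv_beval (T : Type) (a : T -> bool) (b c : bexp T) :
  ba_equiv b c -> beval a b = beval a c.
Proof.
elim=> //= *; do ?[congruence];
  by do ![match goal with |- context [beval a ?b] => case: (beval a b) end].
Qed.

(** * Atoms as truth assignments *)

Section Atoms.
Variable T : finType.
Implicit Types (a : atom T) (b : bexp T).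

Lemma beval_atom a : beval a (atom_bexp a).
Proof.
rewrite /atom_bexp; elim: (enum T) => //= t s ->; rewrite andbT.
by case E: (a t) => /=; rewrite E.
Qed.

Lemma atom_and_prim a t :
  ba_equiv (BAnd (atom_bexp a) (BPrim t)) (if a t then atom_bexp a else BZero).
Proof.
rewrite /atom_bexp; have: t \in enum T by rewrite mem_enum.
(* If the head literal is the one on [t], it absorbs [t] or annihilates it; otherwise the tail
   decides [t]. *)
elim: (enum T) => //= u s IHs; rewrite inE => /predU1P[<- | /IHs ts].
  case: (a t); first by rewrite BA_andC BA_andA ba_andxx.
  by rewrite BA_andC BA_andA BA_andN BA_andC ba_andx0.
by rewrite -BA_andA ts; case: (a t); rewrite ?ba_andx0.
Qed.

(** An atom decides every expression: it is either below it or disjoint from it. This is what makes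
    truth under [a] derivable from the axioms. *)
Lemma atom_and a b :
  ba_equiv (BAnd (atom_bexp a) b) (if beval a b then atom_bexp a else BZero).
Proof.
elim: b => /= [||t|b IHb c IHc|b IHb c IHc|b IHb].
- exact: ba_andx0.
- exact: BA_and1.
- exact: atom_and_prim.
- rewrite BA_andA IHb; case: (beval a b) => //=.
  by rewrite BA_andC ba_andx0.
- rewrite BA_and_or IHb IHc.
  by case: (beval a b); case: (beval a c) => /=;
    rewrite ?ba_orxx ?BA_or0 // BA_orC BA_or0.
- exact: ba_andNE.
Qed.

(** Soundness gives one direction, as [a] satisfies its own conjunction of literals; [atom_and]
    gives the other. *)
Lemma test_semP a b : test_sem b a <-> beval a b.
Proof.
split=> [/(ba_equiv_beval a)/= <-|ab]; first by rewrite beval_atom.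
by apply/ba_leP; rewrite atom_and ab.
Qed.

End Atoms.

(** * Running guarded strings in an arbitrary interpretation *)

Section Runs.
Variables (Sigma : Type) (T : finType) (i : rel_interp Sigma T).
Implicit Types (s : State i) (L K : set (gstring Sigma T)).

Definition state_atom s : atom T := [ffun t => `[< sat i t s >]].

Lemma sat_daggerP b s : sat_dagger i b s <-> test_sem b (state_atom s).
Proof.
apply: iff_trans (iff_sym (test_semP _ _)).
elim: b => //= [t|b IHb c IHc|b IHb c IHc|b IHb].
- by rewrite ffunE; split=> [/asboolP|/asboolP].
- split=> [[/IHb-> /IHc->]//|/andP[/IHb ? /IHc ?]]; by split.
- split=> [[/IHb->|/IHc->]|/orP[/IHb ?|/IHc ?]]; rewrite ?orbT //;
    by [left | right].
- by split=> [nb|/negP nb] //; [apply/negP => /IHb | move=> /IHb].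
Qed.

Fixpoint run (a : atom T) (w : seq (Sigma * atom T)) s s' : Prop :=
  state_atom s = a /\
  if w is (p, b) :: w' then exists2 s1, eval i p (s, s1) & run b w' s1 s'
  else s = s'.

Definition lang_rel L s s' : Prop := exists2 x, L x & run x.1 x.2 s s'.

Lemma run_first a w s s' : run a w s s' -> state_atom s = a.
Proof. by case: w => [|[p b] w] []. Qed.

Lemma run_last a w s s' :
  run a w s s' -> last a (map snd w) = state_atom s'.
Proof.
elim: w a s => [|[p b] w IHw] a s /=; first by case=> <- <-.
by case=> _ [s1 _ /IHw].
Qed.

Lemma run_cat a w w' s s' :
  run a (w ++ w') s s' <->
  exists2 s1, run a w s s1 & run (last a (map snd w)) w' s1 s'.
Proof.
elim: w a s => [|[p b] w IHw] a s /=.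
  split=> [r|[_ [_ <-]] //]; exists s => //; by split=> //; exact: run_first r.
split=> [[sa [s1 ps /IHw[s2 r r']]]|[s2 [sa [s1 ps r]] r']].
  by exists s2 => //; split=> //; exists s1.
by split=> //; exists s1 => //; apply/IHw; exists s2.
Qed.

(** Fusion becomes relational composition. Its partiality is harmless: when two runs meet in a
    state, the last atom of the first string and the first atom of the second are both the atom of
    that state. *)
Lemma lang_rel_fusion L K s s' :
  lang_rel (lang_fusion L K) s s' <->
  exists2 s1, lang_rel L s s1 & lang_rel K s1 s'.
Proof.
split=> [[z [x [y [Lx Ky]]]]|[s1 [x Lx xr] [y Ky yr]]].
  rewrite /fusion; case: eqP => // xy [<-] /= /run_cat[s1 xr yr].
  by exists s1; [exists x | exists y => //; rewrite -xy].
have xy : gs_last x = y.1.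
  by rewrite /gs_last (run_last xr) (run_first yr).
exists (x.1, x.2 ++ y.2).
  by exists x, y; split=> //; rewrite /fusion xy eqxx.
by apply/run_cat; exists s1; rewrite // -/(gs_last x) xy.
Qed.

Lemma lang_rel_at B s s' :
  lang_rel (at_lang B) s s' <-> B (state_atom s) /\ s = s'.
Proof.
split=> [[_ [a Ba <-] [/= -> ->]] //|[Bs <-]].
by exists (state_atom s, [::]) => //; exists (state_atom s).
Qed.

Lemma lang_rel_guard B L s s' :
  lang_rel (lang_fusion (at_lang B) L) s s' <->
  B (state_atom s) /\ lang_rel L s s'.
Proof.
split=> [/lang_rel_fusion[s1 /lang_rel_at[Bs <-]] //|[Bs Ls]].
by apply/lang_rel_fusion; exists s => //; apply/lang_rel_at.
Qed.

Lemma lang_rel_ite B L K s s' :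
  lang_rel (lang_ite B L K) s s' <->
  (B (state_atom s) /\ lang_rel L s s') \/
  (~ B (state_atom s) /\ lang_rel K s s').
Proof.
split=> [[x [Bx|Bx] r]|[/lang_rel_guard|/(lang_rel_guard (~` B))] [x Bx r]].
- by left; apply/lang_rel_guard; exists x.
- by right; apply/(lang_rel_guard (~` B)); exists x.
- by exists x => //; left.
- by exists x => //; right.
Qed.

(** [lang_pow] adds factors on the right, whereas [RWhileT] unrolls a loop on the left; this lemma
    reconciles the two. *)
Lemma lang_rel_pow_cons L n s s1 s' :
  lang_rel L s s1 -> lang_rel (lang_pow L n) s1 s' ->
  lang_rel (lang_pow L n.+1) s s'.
Proof.
move=> Ls; elim: n s' => [|n IHn] s' /=.
  move=> /lang_rel_at[_ <-]; apply/lang_rel_fusion; exists s => //.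
  exact/lang_rel_at.
move=> /lang_rel_fusion[s2 /IHn Ls2 s2s']; apply/lang_rel_fusion.
by exists s2.
Qed.

Lemma lang_rel_bigcup (F : nat -> set (gstring Sigma T)) s s' :
  lang_rel (\bigcup_n F n) s s' <-> exists n, lang_rel (F n) s s'.
Proof.
split=> [[x [n _ Fx] r]|[n [x Fx r]]]; first by exists n, x.
by exists x => //; exists n.
Qed.

Lemma lang_rel_while B L s s' :
  lang_rel (lang_while B L) s s' <->
  exists n, lang_rel (lang_pow (lang_fusion (at_lang B) L) n) s s' /\
            ~ B (state_atom s').
Proof.
split=> [/lang_rel_bigcup[n /lang_rel_fusion[s1 r /lang_rel_at[Bs1 <-]]]|].
  by exists n.
move=> [n [r Bs']]; apply/lang_rel_bigcup; exists n; apply/lang_rel_fusion.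
by exists s' => //; apply/lang_rel_at.
Qed.

Lemma rel_sem_lang_rel e q : rel_sem i e q -> lang_rel (lang_sem e) q.1 q.2.
Proof.
elim=> {e q} /=.
- move=> p s s' ps; exists (state_atom s, [:: (p, state_atom s')]).
    by exists (state_atom s), (state_atom s').
  by split=> //; exists s'.
- by move=> b s /sat_daggerP bs; apply/lang_rel_at.
- by move=> e f s s' s'' _ IHe _ IHf; apply/lang_rel_fusion; exists s'.
- by move=> b e f s s' /sat_daggerP bs _ IHe; apply/lang_rel_ite; left.
- move=> b e f s s' bs _ IHf; apply/lang_rel_ite; right; split=> //.
  by move=> /sat_daggerP.
- move=> b e s s' s'' /sat_daggerP bs _ IHe _ /lang_rel_while[n [IHn bs'']].
  apply/lang_rel_while; exists n.+1; split=> //.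
  by apply: lang_rel_pow_cons IHn; apply/lang_rel_guard.
- move=> b e s bs; apply/lang_rel_while; exists 0; split.
    exact/lang_rel_at.
  by move=> /sat_daggerP.
Qed.

Lemma lang_rel_rel_sem e s s' :
  lang_rel (lang_sem e) s s' -> rel_sem i e (s, s').
Proof.
elim: e s s' => /= [p|b|e IHe f IHf|b e IHe f IHf|b e IHe] s s'.
- by case=> _ [a [b ->]] /= [_ [s1 ps [_ <-]]]; exact: RAct.
- by move=> /lang_rel_at[/sat_daggerP bs <-]; exact: RTest.
- by move=> /lang_rel_fusion[s1 /IHe ? /IHf]; exact: RSeq.
- move=> /lang_rel_ite[[/sat_daggerP bs /IHe]|[bs /IHf]]; first exact: RIteT.
  by apply: RIteF => /sat_daggerP.
- move=> /lang_rel_while[n [r bs']].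
  have: rel_sem i (While b e) (s', s') by apply: RWhileF => /sat_daggerP.
  (* Only the state where the power ends and the remaining loop starts is generalised; the final
     state stays fixed. Each step takes the last iteration off the power and puts it in front of the
     loop already derived. *)
  move: {bs'} r; elim: n {1 2}s' => [|n IHn] s1 /=.
    by move=> /lang_rel_at[_ ->].
  move=> /lang_rel_fusion[s2 r /lang_rel_guard[/sat_daggerP bs2 /IHe r']] r1.
  by apply: IHn r _; exact: RWhileT r' r1.
Qed.

Lemma rel_semE e : rel_sem i e = [set q | lang_rel (lang_sem e) q.1 q.2].
Proof.
apply/seteqP; split=> [q|[s s']]; first exact: rel_sem_lang_rel.
exact: lang_rel_rel_sem.
Qed.

End Runs.

(** * The interpretation on guarded strings *)

Section GuardedStringInterpretation.
Variables (Sigma : Type) (T : finType).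

Definition gs_interp : rel_interp Sigma T := {|
  State := gstring Sigma T;
  eval := fun p => [set q | exists b, q.2 = (q.1.1, rcons q.1.2 (p, b))];
  sat := fun t => [set x | gs_last x t]
|}.

Lemma state_atom_gs (x : gstring Sigma T) :
  @state_atom _ _ gs_interp x = gs_last x.
Proof. by apply/ffunP => t; rewrite ffunE /= asboolb. Qed.

(** By induction on [w] with [x] varying, since each step of the run moves the first letter of [w]
    to the end of [x]. *)
Lemma run_gsP a w (x y : gstring Sigma T) :
  @run _ _ gs_interp a w x y <-> fusion x (a, w) = Some y.
Proof.
rewrite /fusion /=; elim: w a x => [|[p b] w IHw] a x /=; rewrite state_atom_gs.
  rewrite cats0 -surjective_pairing.
  by split=> [[-> ->]|]; [rewrite eqxx | case: eqP => // -> [->]].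
have gs_last_rcons c : gs_last (x.1, rcons x.2 (p, c)) = c.
  by rewrite /gs_last /= map_rcons last_rcons.
split=> [[-> [_ [c /= ->]]]|].
  (* An action may append any atom [c], but the rest of the run starts by checking that the current
     atom is [b]. *)
  by move=> /IHw; rewrite gs_last_rcons /= cat_rcons eqxx; case: (c =P b) => // ->.
case: eqP => // xa xy; split=> //.
exists (x.1, rcons x.2 (p, b)); first by exists b.
by apply/IHw; rewrite gs_last_rcons eqxx /= cat_rcons.
Qed.

(** A one-atom string is a left unit for fusion wherever the fusion is defined, so the only string
    whose run leads from [(x.1, [::])] to [x] is [x] itself. *)
Lemma lang_rel_gs (L : set (gstring Sigma T)) (x : gstring Sigma T) :
  @lang_rel _ _ gs_interp L (x.1, [::]) x <-> L x.
Proof.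
split=> [[y Ly /run_gsP]|Lx].
  rewrite /fusion /gs_last /=; case: eqP => //= xy [<-].
  by move: Ly; rewrite xy -!surjective_pairing.
exists x => //; apply/run_gsP.
by rewrite /fusion /gs_last /= eqxx -surjective_pairing.
Qed.

End GuardedStringInterpretation.

Theorem theorem2p4 (Sigma : Type) (T : finType)
    (hSigma : inhabited Sigma) (hT : inhabited T)
    (e f : exp Sigma T) :
  lang_sem e = lang_sem f <->
  (forall i : rel_interp Sigma T, rel_sem i e = rel_sem i f).
Proof.
split=> [ef i|ef]; first by rewrite !rel_semE ef.
have /seteqP[sub_ef sub_fe] := ef (gs_interp Sigma T).
apply/seteqP; split=> x /lang_rel_gs.
  by move=> /lang_rel_rel_sem/sub_ef/rel_sem_lang_rel/lang_rel_gs.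
by move=> /lang_rel_rel_sem/sub_fe/rel_sem_lang_rel/lang_rel_gs.
Qed.
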